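(* For $\eta\in(0,1)$ and $n\in\mathbb{N}=\{1,2,\dots\}$ let $s_n(\eta)$ be the $n$-th smallest positive zero of $s\mapsto P_{-is-\frac12}\left(\frac{1+\eta}{1-\eta}\right)$, and let $E_{\mathcal N,n}(\eta)=-\log_2\tanh(\pi s_n(\eta))$. Let $j_{0,n}$ be the $n$-th positive zero of the Bessel function $J_0$. Then for each fixed $n$, as $\eta\to0^+$, $$s_n(\eta)\sim\frac{j_{0,n}}{2\sqrt\eta},\qquad E_{\mathcal N,n}(\eta)\sim\frac{2}{\ln 2}\,e^{-\pi j_{0,n}/\sqrt\eta}.$$ In particular, for two intervals of equal length $\ell$ separated by distance $d$, for which $\eta=(1+d/\ell)^{-2}$, one has $E_{\mathcal N,n}\sim\frac{2}{\ln2}\,e^{-\pi j_{0,n}(1+d/\ell)}$ as $d/\ell\to\infty$.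
   Context: $P_{-is-\frac12}(y)={}_2F_1\left(\tfrac12+is,\tfrac12-is;1;\tfrac{1-y}{2}\right)$ for $y>1$. The symbol $\sim$ means that the ratio of the two sides tends to $1$. $E_{\mathcal N,n}$ is the logarithmic negativity of the $n$-th (right-moving) mode pair between two disjoint intervals with cross ratio $\eta$ in the vacuum of the $(1+1)$-dimensional massless scalar field. *)

(* Defs.v *)
From Stdlib Require Import Reals Factorial List ClassicalEpsilon.
From Coquelicot Require Import Coquelicot.

Open Scope R_scope.

(** * Gauss hypergeometric function *)

Fixpoint rising (a : C) (k : nat) : C :=
  match k with
  | O => RtoC 1
  | S k' => (rising a k' * (a + RtoC (INR k')))%C
  end.

Definition hyp2F1_coef (a b c : C) (k : nat) : C :=
  (rising a k * rising b k / (rising c k * RtoC (INR (fact k))))%C.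

Definition analytic_at (g : C -> C) (p : C) : Prop :=
  exists b : nat -> C,
    locally p (fun x : C => is_pseries b (x - p)%C (g x)).

(** The Gauss series inside the unit disc; elsewhere its analytic continuation
    along the segment from [0] to [z]. On the plane cut along [1, +oo), which is
    star-shaped about [0], this is the principal branch. *)
Definition is_hyp2F1 (a b c z w : C) : Prop :=
  (Cmod z < 1 /\ is_pseries (hyp2F1_coef a b c) z w) \/
  (1 <= Cmod z /\
   exists g : C -> C,
     (forall t : R, 0 <= t <= 1 -> analytic_at g (RtoC t * z)%C) /\
     locally (RtoC 0) (fun x : C => is_pseries (hyp2F1_coef a b c) x (g x)) /\
     g z = w).

Definition hyp2F1 (a b c z : C) : C :=
  epsilon (inhabits (RtoC 0)) (is_hyp2F1 a b c z).

(** [conicalP s y] is P_{-is-1/2}(y) for [1 < y]. *)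
Definition conicalP (s y : R) : C :=
  hyp2F1 (RtoC (1 / 2) + Ci * RtoC s)%C (RtoC (1 / 2) - Ci * RtoC s)%C
         (RtoC 1) (RtoC ((1 - y) / 2)).

Definition besselJ0 (x : R) : R :=
  Series (fun k => (-1) ^ k / (INR (fact k)) ^ 2 * (x / 2) ^ (2 * k)).

(** * Ordered positive zeros *)

(** [x] is a positive zero of [f] and there are exactly [n] zeros in (0, x];
    the count starts at [n = 1], and no [x] qualifies for [n = 0]. *)
Definition is_nth_pos_zero {V : AbelianGroup} (f : R -> V) (n : nat) (x : R)
  : Prop :=
  0 < x /\ f x = zero /\
  exists l : list R, NoDup l /\ length l = n /\
    forall t : R, In t l <-> (0 < t <= x /\ f t = zero).

Definition nth_pos_zero {V : AbelianGroup} (f : R -> V) (n : nat) : R :=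
  epsilon (inhabits 0) (is_nth_pos_zero f n).

Definition j0 (n : nat) : R := nth_pos_zero besselJ0 n.

Definition s_zero (n : nat) (eta : R) : R :=
  nth_pos_zero (fun s : R => conicalP s ((1 + eta) / (1 - eta))) n.

Definition log_neg (n : nat) (eta : R) : R :=
  - (ln (tanh (PI * s_zero n eta)) / ln 2).

(** * Asymptotics *)

Definition asymp_equiv {T : Type} (F : (T -> Prop) -> Prop) (f g : T -> R)
  : Prop :=
  filterlim (fun t => f t / g t) F (locally 1).

(** The regime d/l -> +oo over pairs (l, d) of positive lengths, with neither
    of the two held fixed. *)
Definition large_separation (P : R * R -> Prop) : Prop :=
  exists M : R, forall l d : R, 0 < l -> 0 < d -> M < d / l -> P (l, d).

(** Cross ratio of the disjoint intervals [a1, b1] and [a2, b2], b1 < a2;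
    it lies in (0, 1) and tends to 0 as the intervals move far apart. *)
Definition cross_ratio (a1 b1 a2 b2 : R) : R :=
  ((b1 - a1) * (b2 - a2)) / ((a2 - a1) * (b2 - b1)).

(* Main.v *)
(** With [w = eta / (1 - eta)] and [t = w s^2], the function
    [P_{-is-1/2} ((1 + eta) / (1 - eta))] becomes
    [f_w t = sum_k (-1)^k prod_(j < k) (t + (j + 1/2)^2 w) / (k!)^2],
    and [f_0 (x^2 / 4) = J_0 x]. The coefficients being nonnegative, comparison with
    [w = 1/2] shows that [f_w - f_0] is [O(w)] in the Lipschitz norm of every
    [[0, T]]. The zeros of [f_0] are simple, by its differential equation, so the
    [n]-th zero of [f_w] is within [O(w)] of the [n]-th zero of [f_0]. Hence
    [s_n = j_{0,n} / (2 sqrt eta) + O(sqrt eta)], an error small enough to be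
    exponentiated. *)

Require Import Defs.
From Stdlib Require Import Reals Lra Lia Psatz Factorial List Classical ClassicalEpsilon Ranalysis5.
From Coquelicot Require Import Coquelicot.
Open Scope R_scope.

(** * Ordered zeros under a Lipschitz perturbation *)

(** The zeros are named by a choice operator, so nothing is known of [s_zero n eta] or [j0 n] until
    a point with an exact count of zeros up to it is exhibited. This has two consequences. That
    [J_0] has infinitely many positive zeros must itself be proved, here by a sign argument on its
    differential equation. And the deformation may neither create nor lose a zero below the [n]-th:
    uniform closeness excludes zeros where [f_0] is bounded away from 0, but near a zero of [f_0] it
    would still allow several zeros of [f_w]. Closeness of the difference quotients makes [f_w]
    strictly monotone there, and so spares any differentiation of [f_w]. The variable [t] is the
    right one because [s_n] escapes to infinity as [eta] tends to 0, while [w s_n^2] converges to a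
    positive number. *)

Lemma is_nth_pos_zero_le {V : AbelianGroup} (f : R -> V) n x y :
  is_nth_pos_zero f n x -> is_nth_pos_zero f n y -> y <= x.
Proof.
intros (Hx & fx & l & Nl & Ll & Hl) (Hy & fy & l' & Nl' & Ll' & Hl').
destruct (Rle_lt_dec y x) as [|Hxy]; [assumption|exfalso].
assert (Hin : incl (y :: l) l').
{ intros t [<-|Ht]; apply Hl'; [split; [lra|assumption]|].
  apply Hl in Ht; split; [lra|tauto]. }
apply NoDup_incl_length in Hin; [simpl in Hin; lia|].
constructor; [|assumption].
intros Hy'; apply Hl in Hy'; lra.
Qed.

Lemma nth_pos_zero_eq {V : AbelianGroup} (f : R -> V) n x :
  is_nth_pos_zero f n x -> nth_pos_zero f n = x.
Proof.
intros Hx.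
assert (He : is_nth_pos_zero f n (nth_pos_zero f n))
  by (unfold nth_pos_zero; apply epsilon_spec; now exists x).
apply Rle_antisym; eapply is_nth_pos_zero_le; eassumption.
Qed.

Lemma is_nth_pos_zero_1 {V : AbelianGroup} (f : R -> V) x :
  0 < x -> f x = zero -> (forall t, 0 < t < x -> f t <> zero) ->
  is_nth_pos_zero f 1 x.
Proof.
intros Hx fx Hn; repeat split; [assumption|assumption|].
exists (x :: nil); repeat split.
- constructor; [intros []|constructor].
- destruct H as [<-|[]]; lra.
- destruct H as [<-|[]]; lra.
- destruct H as [<-|[]]; assumption.
- intros [Ht ft]; left.
  destruct (Rlt_dec t x); [|lra].
  now elim (Hn t).
Qed.

Lemma is_nth_pos_zero_S {V : AbelianGroup} (f : R -> V) n x y :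
  is_nth_pos_zero f n x -> x < y -> f y = zero ->
  (forall t, x < t < y -> f t <> zero) -> is_nth_pos_zero f (S n) y.
Proof.
intros (Hx & fx & l & Nl & Ll & Hl) Hxy fy Hn.
split; [lra|split; [assumption|]].
exists (y :: l); split; [|split].
- constructor; [|assumption]; intros Hy; apply Hl in Hy; lra.
- simpl; congruence.
- intros t; split.
  + intros [<-|Ht]; [split; [lra|assumption]|].
    apply Hl in Ht; split; [lra|tauto].
  + intros [Ht ft]; destruct (Rle_lt_dec t x).
    * right; apply Hl; split; [lra|assumption].
    * left; destruct (Rlt_dec t y); [|lra].
      now elim (Hn t).
Qed.

(** The map [s -> c * s^2] is an increasing bijection of the positive half-line, so it preserves the
    rank of a zero. It serves with [c = w] for the complex-valued conical function and with
    [c = 1/4] for [J_0]. *)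
Lemma is_nth_pos_zero_sqrt {V W : AbelianGroup} (f : R -> V) (g : R -> W) c n x :
  0 < c -> (forall s, 0 < s -> (g s = zero <-> f (c * s ^ 2) = zero)) ->
  is_nth_pos_zero f n x -> is_nth_pos_zero g n (sqrt (x / c)).
Proof.
intros Hc Hfg (Hx & fx & l & Nl & Ll & Hl).
assert (Hq : forall t, 0 < t -> 0 < sqrt (t / c))
  by (intros t Ht; apply sqrt_lt_R0, Rdiv_lt_0_compat; assumption).
assert (Hs : forall t, 0 < t -> c * sqrt (t / c) ^ 2 = t).
{ intros t Ht; rewrite pow2_sqrt; [field; lra|].
  apply Rlt_le, Rdiv_lt_0_compat; assumption. }
split; [now apply Hq|split].
{ apply Hfg; [now apply Hq|]; now rewrite Hs. }
exists (map (fun t => sqrt (t / c)) l); split; [|split].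
- apply NoDup_map_NoDup_ForallPairs; [|assumption].
  intros t u Ht Hu E; apply Hl in Ht, Hu.
  rewrite <- (Hs t), <- (Hs u), E; tauto.
- now rewrite length_map.
- intros s; rewrite in_map_iff; split.
  + intros (t & <- & Ht); apply Hl in Ht; destruct Ht as [Ht ft].
    split; [split; [now apply Hq|]|].
    * apply sqrt_le_1_alt, Rmult_le_compat_r; [apply Rlt_le, Rinv_0_lt_compat|]; lra.
    * apply Hfg; [now apply Hq|]; now rewrite Hs.
  + intros [[Hs0 Hsx] gs]; exists (c * s ^ 2).
    assert (E : c * s ^ 2 / c = s ^ 2) by (field; lra).
    split; [rewrite E; apply sqrt_pow2; lra|].
    apply Hl; split; [|now apply Hfg].
    split; [apply Rmult_lt_0_compat; [|apply pow_lt]; assumption|].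
    rewrite <- (Hs x Hx).
    apply Rmult_le_compat_l; [lra|]; apply pow_incr; lra.
Qed.

Lemma continuity_pt_neq_0 (g : R -> R) x :
  continuity_pt g x -> g x <> 0 ->
  exists e, 0 < e /\ forall t, Rabs (t - x) < e -> g t <> 0.
Proof.
intros Cg gx.
destruct (Cg (Rabs (g x))) as (e & He & Hc); [now apply Rabs_pos_lt|].
exists e; split; [assumption|]; intros t Ht gt.
destruct (Req_dec t x) as [->|Htx]; [contradiction|].
assert (H : Rabs (g t - g x) < Rabs (g x)).
{ apply Hc; split; [split; [exact I|now apply not_eq_sym]|exact Ht]. }
rewrite gt, Rminus_0_l, Rabs_Ropp in H; lra.
Qed.

(** The next zero is the supremum of the zero-free stretches starting at [a]: were [g] nonzero
    there, continuity would prolong the stretch. The point [a] may itself be a zero, so a zero-free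
    strip of width [e] to its right keeps the supremum away from [a]. *)
Lemma next_zero (g : R -> R) a e z :
  (forall t, continuity_pt g t) -> 0 < e ->
  (forall t, a < t < a + e -> g t <> 0) -> a < z -> g z = 0 ->
  exists m, a < m /\ g m = 0 /\ forall t, a < t < m -> g t <> 0.
Proof.
intros Cg He Hne Hz gz.
set (E := fun x => forall t, a < t <= x -> g t <> 0).
assert (Ez : forall x, E x -> x <= z).
{ intros x Ex; destruct (Rle_lt_dec x z); [assumption|].
  elim (Ex z); [lra|assumption]. }
destruct (completeness E) as [m [Hub Hlub]].
{ exists z; exact Ez. }
{ exists a; intros t Ht; lra. }
assert (Hm : a + e / 2 <= m).
{ apply Hub; intros t Ht; apply Hne; lra. }
assert (Hlt : forall t, a < t < m -> g t <> 0).
{ intros t Ht gt.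
  assert (m <= t); [|lra].
  apply Hlub; intros x Ex; destruct (Rle_lt_dec x t); [assumption|].
  elim (Ex t); [lra|assumption]. }
exists m; split; [lra|split; [|assumption]].
destruct (Req_dec (g m) 0) as [|gm]; [assumption|exfalso].
destruct (continuity_pt_neq_0 g m (Cg m) gm) as (d & Hd & Hc).
assert (m + d / 2 <= m); [|lra].
apply Hub; intros t Ht.
destruct (Rlt_dec t m); [apply Hlt; lra|].
apply Hc; rewrite Rabs_pos_eq; lra.
Qed.

Lemma nonzero_bounded_below (g : R -> R) a b :
  (forall t, continuity_pt g t) -> (forall t, a <= t <= b -> g t <> 0) ->
  exists m, 0 < m /\ forall t, a <= t <= b -> m <= Rabs (g t).
Proof.
intros Cg Hn.
destruct (Rle_lt_dec a b) as [Hab|Hab]; [|exists 1; split; [lra|intros; lra]].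
destruct (continuity_ab_min (fun t => Rabs (g t)) a b Hab) as (m & Hm & Hmab).
{ intros c _; apply (continuity_pt_comp g Rabs); [apply Cg|apply Rcontinuity_abs]. }
exists (Rabs (g m)); split; [now apply Rabs_pos_lt, Hn|assumption].
Qed.

Lemma is_derive_continuity_pt (f : R -> R) x l : is_derive f x l -> continuity_pt f x.
Proof.
intros H; apply continuity_pt_filterlim.
apply (ex_derive_continuous (K := R_AbsRing) (V := R_NormedModule)); now exists l.
Qed.

(* The sign [s] makes [s * g] increasing on the neighbourhood. *)
Definition transverse_on (g : R -> R) (s c r x : R) : Prop :=
  forall t u, x - r <= u -> u <= t -> t <= x + r -> c * (t - u) <= s * (g t - g u).

Lemma transverse_of_derive (g dg : R -> R) x :
  (forall t, is_derive g t (dg t)) -> continuity_pt dg x -> dg x <> 0 ->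
  exists s c r, (s = 1 \/ s = -1) /\ 0 < c /\ 0 < r /\ transverse_on g s c r x.
Proof.
intros Dg Cdg Hx.
destruct (Cdg (Rabs (dg x) / 2)) as (d & Hd & Hc).
{ apply Rdiv_lt_0_compat; [now apply Rabs_pos_lt|lra]. }
(* Within [d] of [x] the derivative keeps its sign and at least half its size; the radius is halved
   because continuity gives an open ball and transversality asks for a closed one. *)
exists (sign (dg x)), (Rabs (dg x) / 2), (d / 2).
assert (Hs : sign (dg x) * dg x = Rabs (dg x) /\ (sign (dg x) = 1 \/ sign (dg x) = -1)).
{ destruct (Rlt_dec 0 (dg x)).
  - rewrite sign_eq_1, Rabs_pos_eq by lra; lra.
  - rewrite sign_eq_m1, Rabs_left by lra; lra. }
destruct Hs as [Hs Hs1].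
split; [assumption|split; [|split; [lra|]]].
{ apply Rdiv_lt_0_compat; [now apply Rabs_pos_lt|lra]. }
intros t u Hu Hut Ht.
destruct (MVT_gen g u t dg) as (y & Hy & E).
{ intros; apply Dg. }
{ intros; eapply is_derive_continuity_pt; apply Dg. }
rewrite Rmin_left, Rmax_right in Hy by lra.
rewrite E, <- Rmult_assoc; apply Rmult_le_compat_r; [lra|].
assert (Hy' : Rabs (dg y - dg x) <= Rabs (dg x) / 2).
{ destruct (Req_dec y x) as [->|Hyx].
  - rewrite Rminus_diag, Rabs_R0. generalize (Rabs_pos (dg x)); lra.
  - apply Rlt_le, (Hc y); split; [split; [exact I|lra]|].
    simpl; unfold R_dist; apply Rabs_lt_between'; lra. }
apply Rabs_le_between' in Hy'.
destruct Hs1 as [E1|E1]; rewrite E1 in *; lra.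
Qed.

(** [f w] tends to [g] at linear rate in [w], in the Lipschitz norm of each
    [[0, X]]. *)
Definition linear_deformation (f : R -> R -> R) (g : R -> R) : Prop :=
  forall X, 0 <= X -> exists K, 0 < K /\
    forall w t u, 0 <= w <= 1 / 2 -> 0 <= t <= X -> 0 <= u <= X ->
      Rabs (f w t - g t) <= K * w /\
      Rabs ((f w t - g t) - (f w u - g u)) <= K * w * Rabs (t - u).

Lemma linear_deformation_continuity f g w t :
  (forall t, continuity_pt g t) -> linear_deformation f g ->
  0 <= w <= 1 / 2 -> 0 < t -> continuity_pt (f w) t.
Proof.
intros Cg Hf Hw Ht.
(* The interval up to [2 * t] contains a two-sided neighbourhood of [t]. *)
destruct (Hf (2 * t)) as (K & HK & H); [lra|].
apply continuity_pt_ext_loc with (fun u => (f w u - g u) + g u).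
{ apply filter_forall; intros; ring. }
apply continuity_pt_plus; [|apply Cg].
intros e He; exists (Rmin t (e / (K + 1))); split.
{ apply Rmin_case; [lra|]; apply Rdiv_lt_0_compat; lra. }
intros u [_ Hu]; simpl in *; unfold R_dist in *.
assert (Hu1 := Rlt_le_trans _ _ _ Hu (Rmin_l _ _)).
assert (Hu2 := Rlt_le_trans _ _ _ Hu (Rmin_r _ _)).
apply Rabs_lt_between in Hu1.
destruct (H w u t Hw) as [_ H2]; [lra|lra|].
apply Rle_lt_trans with (1 := H2).
apply Rle_lt_trans with ((K + 1) * Rabs (u - t)).
{ apply Rmult_le_compat_r; [apply Rabs_pos|nra]. }
apply Rmult_lt_reg_r with (/ (K + 1)); [apply Rinv_0_lt_compat; lra|].
replace ((K + 1) * Rabs (u - t) * / (K + 1)) with (Rabs (u - t)) by (field; lra).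
exact Hu2.
Qed.

Lemma transverse_shrink g s c r r' x :
  r' <= r -> transverse_on g s c r x -> transverse_on g s c r' x.
Proof. intros Hr H t u H1 H2 H3; apply H; lra. Qed.

(** The difference quotients of [f w - g] are at most [K * w], which is at most [c / 2] once
    [w < c / (2 * K)]; half of the slope [c] then survives. The condition [r < x] keeps the interval
    inside the half-line where the deformation is controlled. *)
Lemma transverse_deformation f g s c r x :
  linear_deformation f g -> (s = 1 \/ s = -1) -> 0 < c -> 0 < r < x -> transverse_on g s c r x ->
  exists d, 0 < d /\ d <= 1 / 2 /\ forall w, 0 < w < d -> transverse_on (f w) s (c / 2) r x.
Proof.
intros Hf Hs Hc Hr Hg.
destruct (Hf (x + r)) as (K & HK & H); [lra|].
assert (Hd : 0 < c / (2 * K)) by (apply Rdiv_lt_0_compat; lra).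
exists (Rmin (1 / 2) (c / (2 * K))); split; [apply Rmin_case; lra|].
split; [apply Rmin_l|].
intros w Hw t u H1 H2 H3.
assert (Hw1 := Rmin_l (1 / 2) (c / (2 * K))).
assert (Hw2 := Rmin_r (1 / 2) (c / (2 * K))).
destruct (H w t u) as [_ H4]; [lra|lra|lra|].
rewrite (Rabs_pos_eq (t - u)) in H4 by lra.
assert (HKw : K * w <= c / 2).
{ apply Rle_trans with (K * (c / (2 * K))).
  - apply Rmult_le_compat_l; lra.
  - apply Req_le; field; lra. }
assert (H5 : K * w * (t - u) <= c / 2 * (t - u)) by (apply Rmult_le_compat_r; lra).
specialize (Hg t u H1 H2 H3).
apply Rabs_le_between in H4.
destruct Hs as [-> | ->]; lra.
Qed.

Lemma transverse_inj g s c r x t u :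
  0 < c -> transverse_on g s c r x -> Rabs (t - x) <= r -> Rabs (u - x) <= r ->
  g t = g u -> t = u.
Proof.
intros Hc Hg Ht Hu E.
apply Rabs_le_between' in Ht, Hu.
destruct (Rle_lt_dec u t) as [H|H].
- assert (H1 := Hg t u ltac:(lra) H ltac:(lra)).
  rewrite E, Rminus_diag, Rmult_0_r in H1.
  destruct (Rle_lt_or_eq_dec u t H); [nra|easy].
- assert (H1 := Hg u t ltac:(lra) ltac:(lra) ltac:(lra)).
  rewrite E, Rminus_diag, Rmult_0_r in H1; nra.
Qed.

(** On [[a, x - q]] compactness keeps [g] away from 0, and [f w] with it. On [[x - q, x + q]] a sign
    change gives a zero of [f w], and the surviving slope makes it the only one. *)
Lemma first_zero_deformation f g s c r a x :
  (forall t, continuity_pt g t) -> linear_deformation f g ->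
  (s = 1 \/ s = -1) -> 0 < c -> 0 < r -> transverse_on g s c r x ->
  0 <= a < x -> g x = 0 -> (forall t, a <= t < x -> g t <> 0) ->
  exists C d, 0 < C /\ 0 < d /\ forall w, 0 < w < d -> exists y,
    a < y /\ Rabs (y - x) <= C * w /\ f w y = 0 /\ forall t, a <= t < y -> f w t <> 0.
Proof.
intros Cg Hf Hs Hc Hr Hg Ha gx Hn.
set (q := Rmin r ((x - a) / 2)).
assert (Hq : 0 < q) by (apply Rmin_case; lra).
assert (Hqr : q <= r) by apply Rmin_l.
assert (Hqa : q <= (x - a) / 2) by apply Rmin_r.
apply (transverse_shrink g s c r q x Hqr) in Hg.
destruct (transverse_deformation f g s c q x Hf Hs Hc ltac:(lra) Hg) as (d1 & Hd1 & Hd1' & Hfw).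
destruct (nonzero_bounded_below g a (x - q) Cg) as (m & Hm & Hgm).
{ intros t Ht; apply Hn; lra. }
destruct (Hf (x + q)) as (K & HK & H); [lra|].
(* For [w < d2] the error [K * w] is below [m], the minimum of [|g|] on the left part, and below
   [c * q], a lower bound of [|g|] at the two ends [x - q] and [x + q]. *)
set (d2 := Rmin m (c * q) / (2 * K)).
assert (Hmin : 0 < Rmin m (c * q)) by (apply Rmin_case; nra).
assert (Hd2 : 0 < d2) by (apply Rdiv_lt_0_compat; lra).
exists (2 * K / c), (Rmin d1 d2); split; [apply Rdiv_lt_0_compat; lra|].
split; [apply Rmin_case; lra|].
intros w Hw.
assert (Hw1 : w < d1) by (generalize (Rmin_l d1 d2); lra).
assert (Hw2 : w < d2) by (generalize (Rmin_r d1 d2); lra).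
specialize (Hfw w ltac:(lra)).
assert (HKw : K * w < Rmin m (c * q)).
{ apply Rlt_trans with (K * d2); [apply Rmult_lt_compat_l; lra|].
  replace (K * d2) with (Rmin m (c * q) / 2) by (unfold d2; field; lra). lra. }
assert (HKm := Rlt_le_trans _ _ _ HKw (Rmin_l _ _)).
assert (HKc := Rlt_le_trans _ _ _ HKw (Rmin_r _ _)).
assert (Hb : forall t, 0 <= t <= x + q -> Rabs (f w t - g t) <= K * w).
{ intros t Ht; apply (H w t t); lra. }
assert (Hends : s * f w (x - q) < 0 < s * f w (x + q)).
{ assert (H1 := Hg x (x - q) ltac:(lra) ltac:(lra) ltac:(lra)).
  assert (H2 := Hg (x + q) x ltac:(lra) ltac:(lra) ltac:(lra)).
  rewrite gx in H1, H2.
  assert (H3 := Hb (x - q) ltac:(lra)). assert (H4 := Hb (x + q) ltac:(lra)).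
  apply Rabs_le_between in H3, H4.
  destruct Hs as [-> | ->]; lra. }
destruct (IVT_interv (fun t => s * f w t) (x - q) (x + q)) as (y & Hy & fy).
{ intros t Ht; apply continuity_pt_scal, (linear_deformation_continuity f g); try assumption; lra. }
{ lra. }
{ apply Hends. }
{ apply Hends. }
assert (fy0 : f w y = 0) by (destruct Hs as [-> | ->]; lra).
exists y; split; [lra|split; [|split; [assumption|]]].
(* The slope [c / 2] between [x] and the zero [y] turns [|f w x| <= K * w] into a bound on the
   distance, whence the constant [2 * K / c]. *)
- assert (H1 := Hb x ltac:(lra)); rewrite gx, Rminus_0_r in H1.
  assert (H2 : c / 2 * Rabs (y - x) <= Rabs (f w x)).
  { destruct (Rle_lt_dec x y) as [Hxy|Hxy].
    - assert (H2 := Hfw y x ltac:(lra) ltac:(lra) ltac:(lra)).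
      rewrite fy0 in H2; rewrite Rabs_pos_eq by lra.
      apply Rle_trans with (1 := H2); rewrite <- Rabs_Ropp.
      destruct Hs as [-> | ->]; unfold Rabs; destruct (Rcase_abs _); lra.
    - assert (H2 := Hfw x y ltac:(lra) ltac:(lra) ltac:(lra)).
      rewrite fy0 in H2; rewrite Rabs_left by lra.
      replace (- (y - x)) with (x - y) by ring.
      apply Rle_trans with (1 := H2).
      destruct Hs as [-> | ->]; unfold Rabs; destruct (Rcase_abs _); lra. }
  replace (Rabs (y - x)) with (2 / c * (c / 2 * Rabs (y - x))) by (field; lra).
  replace (2 * K / c * w) with (2 / c * (K * w)) by (field; lra).
  apply Rmult_le_compat_l; [apply Rlt_le, Rdiv_lt_0_compat|]; lra.
- intros t Ht ft.
  destruct (Rle_lt_dec t (x - q)) as [Htq|Htq].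
  + assert (H1 := Hb t ltac:(lra)). assert (H2 := Hgm t ltac:(lra)).
    rewrite ft in H1; replace (0 - g t) with (- g t) in H1 by ring.
    rewrite Rabs_Ropp in H1; lra.
  + assert (E : t = y); [|lra].
    apply (transverse_inj (f w) s (c / 2) q x); try assumption; try lra;
      apply Rabs_le_between'; lra.
Qed.

(** Induction on the rank, each step locating the first zero of [f w] after the previous one. In the
    base case [g 0 <> 0] prevents zeros of [f w] from entering at the origin. *)
Theorem nth_zero_deformation (f : R -> R -> R) (g dg : R -> R) :
  linear_deformation f g -> (forall t, is_derive g t (dg t)) ->
  (forall t, continuity_pt dg t) -> g 0 <> 0 ->
  (forall t, 0 < t -> g t = 0 -> dg t <> 0) ->
  (forall A, 0 < A -> exists t, A < t /\ g t = 0) ->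
  forall n, exists x C d, is_nth_pos_zero g (S n) x /\ 0 < C /\ 0 < d /\
    forall w, 0 < w < d -> exists y,
      is_nth_pos_zero (f w) (S n) y /\ Rabs (y - x) <= C * w.
Proof.
intros Hf Dg Cdg g0 Hsimple Hunb.
assert (Cg : forall t, continuity_pt g t).
{ intros t; eapply is_derive_continuity_pt; apply Dg. }
induction n as [|n (x & C & d & Hx & HC & Hd & IH)].
- destruct (Hunb 1 Rlt_0_1) as (z & Hz & gz).
  destruct (continuity_pt_neq_0 g 0 (Cg 0) g0) as (e & He & Hc).
  destruct (next_zero g 0 e z Cg He) as (x & Hx & gx & Hn); [|lra|assumption|].
  { intros t Ht; apply Hc; rewrite Rabs_pos_eq; lra. }
  destruct (transverse_of_derive g dg x Dg (Cdg x)) as (s & c & r & Hs & Hc' & Hr & Ht);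
    [now apply Hsimple|].
  destruct (first_zero_deformation f g s c r 0 x) as (C & d & HC & Hd & H);
    try assumption; [lra| |].
  { intros t [Ht0 Htx]; destruct (Rle_lt_or_eq_dec 0 t Ht0) as [|<-]; [|assumption].
    apply Hn; lra. }
  exists x, C, d; split; [now apply is_nth_pos_zero_1|].
  split; [assumption|split; [assumption|]].
  intros w Hw; destruct (H w Hw) as (y & Hy & Hyx & fy & Hny).
  exists y; split; [|assumption].
  apply is_nth_pos_zero_1; try assumption; intros t Ht'; apply Hny; lra.
- assert (Hx' := Hx); destruct Hx' as (Hx0 & gx & _); change (g x = 0) in gx.
  destruct (Hunb x Hx0) as (z & Hz & gz).
  destruct (transverse_of_derive g dg x Dg (Cdg x)) as (s & c & r & Hs & Hc & Hr & Ht);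
    [now apply Hsimple|].
  destruct (next_zero g x r z Cg Hr) as (x' & Hxx' & gx' & Hn); [|assumption|assumption|].
  { intros t Ht1 gt.
    assert (t = x); [|lra].
    apply (transverse_inj g s c r x); try assumption; try congruence;
      apply Rabs_le_between'; lra. }
  (* The three bounds keep [[x - q, x + q]] positive, inside the region of transversality, and to
     the left of the next zero [x']. *)
  set (q := Rmin (x / 2) (Rmin r ((x' - x) / 2))).
  assert (Hq : 0 < q) by (repeat apply Rmin_case; lra).
  assert (Hq1 : q <= x / 2) by apply Rmin_l.
  assert (Hq2 : q <= r) by (eapply Rle_trans; [apply Rmin_r|apply Rmin_l]).
  assert (Hq3 : q <= (x' - x) / 2) by (eapply Rle_trans; [apply Rmin_r|apply Rmin_r]).
  apply (transverse_shrink g s c r q x Hq2) in Ht.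
  destruct (transverse_deformation f g s c q x Hf Hs Hc ltac:(lra) Ht) as (d1 & Hd1 & _ & Hfw).
  destruct (transverse_of_derive g dg x' Dg (Cdg x')) as (s' & c' & r' & Hs' & Hc' & Hr' & Ht');
    [apply Hsimple; [lra|assumption]|].
  (* The search restarts at [x + q], not at [x], where [g] vanishes and would have no positive lower
     bound. The gap between [y] and [x + q] is closed at the end by injectivity of [f w] near [x];
     the threshold [q / C] ensures that [y] lies there. *)
  destruct (first_zero_deformation f g s' c' r' (x + q) x') as (C' & d' & HC' & Hd' & H);
    try assumption; [lra| |].
  { intros t Ht1; apply Hn; lra. }
  assert (Hd2 : 0 < q / C) by (apply Rdiv_lt_0_compat; lra).
  exists x', C', (Rmin (Rmin d d') (Rmin d1 (q / C))).
  split; [now apply (is_nth_pos_zero_S g (S n) x)|].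
  split; [assumption|split; [repeat apply Rmin_pos; assumption|]].
  intros w [Hw0 Hw].
  apply Rmin_Rgt_l in Hw; destruct Hw as [Hw1 Hw2].
  apply Rmin_Rgt_l in Hw1, Hw2.
  destruct (IH w) as (y & Hy & Hyx); [lra|].
  destruct (H w) as (y' & Hy' & Hyx' & fy' & Hny'); [lra|].
  assert (Hyq : Rabs (y - x) <= q).
  { apply Rle_trans with (1 := Hyx).
    replace q with (C * (q / C)) by (field; lra).
    apply Rmult_le_compat_l; lra. }
  exists y'; split; [|assumption].
  assert (Hyq' := Hyq); apply Rabs_le_between' in Hyq'.
  apply (is_nth_pos_zero_S (f w) (S n) y); [assumption|lra|assumption|].
  intros t Ht1 ft; change (f w t = 0) in ft.
  destruct (Rle_lt_dec (x + q) t) as [H1|H1].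
  + elim (Hny' t); [lra|assumption].
  + assert (t = y); [|lra].
    apply (transverse_inj (f w) s (c / 2) q x); try assumption; try lra.
    * apply Hfw; lra.
    * apply Rabs_le_between'; lra.
    * rewrite ft; symmetry; apply Hy.
Qed.

(** * The Bessel function *)

(** Coefficients of the entire function [J_0 (2 sqrt t)] in powers of [t]. *)
Definition bessel_coef (k : nat) : R := (-1) ^ k / INR (fact k) ^ 2.

Lemma bessel_coef_neq_0 k : bessel_coef k <> 0.
Proof.
unfold bessel_coef; apply Rmult_integral_contrapositive_currified.
- apply pow_nonzero; lra.
- apply Rinv_neq_0_compat, pow_nonzero, INR_fact_neq_0.
Qed.

Lemma bessel_coef_S k : bessel_coef (S k) = - bessel_coef k / INR (S k) ^ 2.
Proof.
unfold bessel_coef; rewrite fact_simpl, mult_INR.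
simpl (_ ^ S k); field.
split; [apply INR_fact_neq_0|apply not_0_INR; lia].
Qed.

Lemma is_lim_seq_inv_INR_S : is_lim_seq (fun n => / INR (S n)) 0.
Proof.
apply is_lim_seq_incr_1 with (u := fun n => / INR n).
replace (Finite 0) with (Rbar_inv p_infty) by reflexivity.
apply is_lim_seq_inv; [apply is_lim_seq_INR|easy].
Qed.

Lemma CV_radius_bessel_coef : CV_radius bessel_coef = p_infty.
Proof.
apply CV_radius_infinite_DAlembert; [apply bessel_coef_neq_0|].
apply is_lim_seq_le_le with (fun _ => 0) (fun n => / INR (S n)).
- intros n; split; [apply Rabs_pos|].
  rewrite bessel_coef_S.
  replace (- bessel_coef n / INR (S n) ^ 2 / bessel_coef n)
    with (- / INR (S n) ^ 2).
  + rewrite Rabs_Ropp.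
    assert (1 <= INR (S n)) by (apply (le_INR 1); lia).
    rewrite Rabs_pos_eq.
    * apply Rinv_le_contravar; nra.
    * apply Rlt_le, Rinv_0_lt_compat; nra.
  + field; split; [apply not_0_INR; lia|apply bessel_coef_neq_0].
- apply is_lim_seq_const.
- exact is_lim_seq_inv_INR_S.
Qed.

Definition bessel_fun : R -> R := PSeries bessel_coef.
Definition bessel_fun' : R -> R := PSeries (PS_derive bessel_coef).
Definition bessel_fun'' : R -> R := PSeries (PS_derive (PS_derive bessel_coef)).

Lemma is_derive_bessel_fun t : is_derive bessel_fun t (bessel_fun' t).
Proof. apply is_derive_PSeries; now rewrite CV_radius_bessel_coef. Qed.

Lemma is_derive_bessel_fun' t : is_derive bessel_fun' t (bessel_fun'' t).
Proof.
apply is_derive_PSeries; now rewrite CV_radius_derive, CV_radius_bessel_coef.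
Qed.

(** Bessel's equation of order 0 in the variable [t = x^2 / 4]; on coefficients it reads
    [(n + 1)^2 c_(n+1) + c_n = 0]. *)
Lemma bessel_fun_ode t : t * bessel_fun'' t + bessel_fun' t + bessel_fun t = 0.
Proof.
unfold bessel_fun, bessel_fun', bessel_fun''.
assert (H1 : ex_pseries bessel_coef t).
{ apply CV_radius_inside; now rewrite CV_radius_bessel_coef. }
assert (H2 : ex_pseries (PS_derive bessel_coef) t).
{ apply CV_radius_inside; now rewrite CV_radius_derive, CV_radius_bessel_coef. }
assert (H3 : ex_pseries (PS_derive (PS_derive bessel_coef)) t).
{ apply CV_radius_inside; now rewrite !CV_radius_derive, CV_radius_bessel_coef. }
rewrite <- PSeries_incr_1.
rewrite <- PSeries_plus; [|now apply ex_pseries_incr_1|assumption].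
rewrite <- PSeries_plus; [|apply ex_pseries_plus; [now apply ex_pseries_incr_1|assumption]|assumption].
rewrite <- (PSeries_const_0 t); apply PSeries_ext; intros n.
unfold PS_plus, PS_incr_1, PS_derive.
assert (E : forall a b c : R, a + b + c = 0 -> plus (plus a b) c = 0) by easy.
destruct n as [|n].
- apply E; rewrite bessel_coef_S; unfold zero; simpl; field.
- apply E; rewrite !bessel_coef_S.
  rewrite (S_INR (S n)), !(S_INR n).
  field; split; generalize (pos_INR n); lra.
Qed.

Lemma bessel_fun_0 : bessel_fun 0 = 1.
Proof.
unfold bessel_fun; rewrite PSeries_0; unfold bessel_coef; simpl; field.
Qed.

Lemma derive_nonpos_le (f df : R -> R) a b :
  a <= b -> (forall t, a <= t <= b -> is_derive f t (df t)) ->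
  (forall t, a <= t <= b -> df t <= 0) -> f b <= f a.
Proof.
intros Hab Hf Hdf.
destruct (MVT_gen f a b df) as (c & Hc & E); rewrite ?Rmin_left, ?Rmax_right in * by lra.
- intros t Ht; apply Hf; lra.
- intros t Ht; eapply is_derive_continuity_pt; now apply Hf.
- specialize (Hdf c Hc); nra.
Qed.

(* The quantity [t (t g'^2 + g^2)] has derivative [g^2], so it cannot return to
   its initial value [0] unless [g] vanishes identically. *)
Lemma bessel_fun_simple_zero t : 0 < t -> bessel_fun t = 0 -> bessel_fun' t <> 0.
Proof.
intros Ht g0 g1.
set (Q := fun u => - (u * (u * bessel_fun' u ^ 2 + bessel_fun u ^ 2))).
assert (HQ : forall u, is_derive Q u (- bessel_fun u ^ 2)).
{ intros u; unfold Q.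
  assert (D0 := is_derive_bessel_fun u). assert (D1 := is_derive_bessel_fun' u).
  auto_derive; [repeat split; eexists; eassumption|].
  replace (Derive (fun x => bessel_fun x) u) with (bessel_fun' u)
    by (symmetry; now apply is_derive_unique).
  replace (Derive (fun x => bessel_fun' x) u) with (bessel_fun'' u)
    by (symmetry; now apply is_derive_unique).
  replace (bessel_fun u) with (- (u * bessel_fun'' u + bessel_fun' u))
    by (generalize (bessel_fun_ode u); lra).
  ring. }
assert (Q0 : forall u, 0 < u <= t -> bessel_fun u = 0).
{ intros u Hu.
  assert (H : Q t <= Q u).
  { apply (derive_nonpos_le Q (fun v => - bessel_fun v ^ 2)); [lra|auto|].
    intros v _; generalize (pow2_ge_0 (bessel_fun v)); lra. }
  unfold Q in H; rewrite g0, g1 in H.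
  assert (H1 := pow2_ge_0 (bessel_fun u)). assert (H2 := pow2_ge_0 (bessel_fun' u)).
  assert (H3 : bessel_fun u ^ 2 = 0) by nra.
  apply Rsqr_0_uniq; rewrite Rsqr_pow2; exact H3. }
destruct (continuity_pt_neq_0 bessel_fun 0) as (d & Hd & Hc).
{ eapply is_derive_continuity_pt, is_derive_bessel_fun. }
{ rewrite bessel_fun_0; lra. }
assert (Hm : 0 < Rmin t (d / 2)) by (apply Rmin_pos; lra).
apply (Hc (Rmin t (d / 2))).
- rewrite Rminus_0_r, Rabs_pos_eq by lra; generalize (Rmin_r t (d / 2)); lra.
- apply Q0; split; [assumption|apply Rmin_l].
Qed.

(** The equation says [(t g')' = - g], so a positive [g] makes [P = t g'] decrease. If [P] ever
    equals [- c < 0], then [g' <= - c / t] from there on and [g] falls at least logarithmically,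
    below any bound. If [P] stays nonnegative, then [g] is nondecreasing, so [P] falls at least
    linearly, again a contradiction. *)
Lemma bessel_ode_not_positive (g g' g'' : R -> R) A :
  0 < A -> (forall t, is_derive g t (g' t)) -> (forall t, is_derive g' t (g'' t)) ->
  (forall t, t * g'' t + g' t + g t = 0) -> ~ (forall t, A <= t -> 0 < g t).
Proof.
intros HA D0 D1 ODE Hpos.
set (P := fun t => t * g' t).
assert (DP : forall t, is_derive P t (- g t)).
{ intros t; unfold P; auto_derive; [eexists; apply D1|].
  replace (Derive (fun x => g' x) t) with (g'' t)
    by (symmetry; now apply is_derive_unique).
  generalize (ODE t); lra. }
destruct (classic (exists t1, A <= t1 /\ P t1 < 0)) as [(t1 & Ht1 & HP)|Hno].
- set (c := - P t1).
  assert (Hc : 0 < c) by (unfold c; lra).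
  (* The point where the upper bound [g t1 - c * ln (t / t1)] reaches 0. *)
  set (t := t1 * exp (g t1 / c)).
  assert (He : 1 <= exp (g t1 / c)).
  { rewrite <- exp_0; apply Rlt_le, exp_increasing, Rdiv_lt_0_compat; [now apply Hpos|assumption]. }
  assert (Ht : t1 <= t) by (unfold t; nra).
  assert (H : g t + c * ln t <= g t1 + c * ln t1).
  { apply (derive_nonpos_le (fun u => g u + c * ln u) (fun u => g' u + c / u)); [assumption| |].
    - intros u Hu; auto_derive; [split; [eexists; apply D0|split; [lra|exact I]]|].
      replace (Derive (fun x => g x) u) with (g' u)
        by (symmetry; now apply is_derive_unique).
      field; lra.
    - intros u Hu.
      assert (H : P u <= P t1).
      { apply (derive_nonpos_le P (fun v => - g v)); [lra|auto|].
        intros v Hv; generalize (Hpos v ltac:(lra)); lra. }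
      unfold P in H at 1.
      replace (g' u + c / u) with ((u * g' u + c) / u) by (field; lra).
      apply Rmult_le_reg_r with u; [lra|].
      unfold Rdiv; rewrite Rmult_assoc, Rinv_l by lra; unfold c; lra. }
  unfold t in H at 2; rewrite ln_mult in H by (try apply exp_pos; lra).
  rewrite ln_exp in H.
  replace (c * (ln t1 + g t1 / c)) with (c * ln t1 + g t1) in H by (field; lra).
  generalize (Hpos t ltac:(lra)); lra.
- assert (HP : forall t, A <= t -> 0 <= P t).
  { intros t Ht; destruct (Rle_lt_dec 0 (P t)); [assumption|].
    elim Hno; now exists t. }
  assert (Hg : forall t, A <= t -> g A <= g t).
  { intros t Ht.
    assert (H : - g t <= - g A); [|lra].
    apply (derive_nonpos_le (fun u => - g u) (fun u => - g' u)); [assumption| |].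
    - intros u _; apply (is_derive_opp g), D0.
    - intros u Hu; specialize (HP u ltac:(lra)); unfold P in HP; nra. }
  assert (HA0 := Hpos A (Rle_refl A)).
  assert (Hq : 0 <= P A / g A) by (apply Rdiv_le_0_compat; [apply HP; lra|assumption]).
  (* One unit past the zero of the upper bound [P A - g A * (t - A)], which therefore equals [- g A]
     here. *)
  set (t := A + P A / g A + 1).
  assert (H : P t + g A * t <= P A + g A * A).
  { apply (derive_nonpos_le (fun u => P u + g A * u) (fun u => - g u + g A)).
    - unfold t; lra.
    - intros u _; apply (is_derive_plus P); [apply DP|].
      auto_derive; [exact I|ring].
    - intros u Hu; generalize (Hg u ltac:(lra)); lra. }
  assert (E : g A * t = g A * A + P A + g A) by (unfold t; field; lra).
  generalize (HP t ltac:(unfold t; lra)); lra.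
Qed.

Lemma bessel_fun_unbounded_zeros A : 0 < A -> exists t, A < t /\ bessel_fun t = 0.
Proof.
intros HA.
destruct (classic (exists t, A < t /\ bessel_fun t = 0)) as [|Hno]; [assumption|exfalso].
assert (Hn : forall t, A + 1 <= t -> bessel_fun t <> 0).
{ intros t Ht E; apply Hno; exists t; split; [lra|assumption]. }
assert (Cg : forall t, continuity_pt bessel_fun t).
{ intros t; eapply is_derive_continuity_pt; apply is_derive_bessel_fun. }
destruct (Rlt_dec 0 (bessel_fun (A + 1))) as [Hp|Hp].
- apply (bessel_ode_not_positive bessel_fun bessel_fun' bessel_fun'' (A + 1));
    [lra|apply is_derive_bessel_fun|apply is_derive_bessel_fun'|apply bessel_fun_ode|].
  intros t Ht.
  destruct (Rlt_dec 0 (bessel_fun t)) as [|Hq]; [assumption|exfalso].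
  assert (Hlt : A + 1 < t).
  { destruct (Req_dec t (A + 1)) as [->|]; [contradiction|lra]. }
  destruct (IVT_interv (fun u => - bessel_fun u) (A + 1) t) as (z & Hz & Ez);
    [intros u _; now apply continuity_pt_opp|lra|lra|generalize (Hn t Ht); lra|].
  apply (Hn z); lra.
- apply (bessel_ode_not_positive (fun t => - bessel_fun t) (fun t => - bessel_fun' t)
    (fun t => - bessel_fun'' t) (A + 1)); [lra| | | |].
  + intros t; apply (is_derive_opp bessel_fun), is_derive_bessel_fun.
  + intros t; apply (is_derive_opp bessel_fun'), is_derive_bessel_fun'.
  + intros t; generalize (bessel_fun_ode t); lra.
  + intros t Ht.
    destruct (Rlt_dec 0 (- bessel_fun t)) as [|Hq]; [assumption|exfalso].
    assert (H1 := Hn t Ht). assert (H2 := Hn (A + 1) ltac:(lra)).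
    assert (Hlt : A + 1 < t).
    { destruct (Req_dec t (A + 1)) as [->|]; lra. }
    destruct (IVT_interv bessel_fun (A + 1) t) as (z & Hz & Ez);
      [intros u _; apply Cg|lra|lra|lra|].
    apply (Hn z); lra.
Qed.

Lemma besselJ0_eq x : besselJ0 x = bessel_fun (1 / 4 * x ^ 2).
Proof.
unfold besselJ0, bessel_fun, PSeries; apply Series_ext; intros k.
unfold bessel_coef; rewrite pow_mult.
replace ((x / 2) ^ 2) with (1 / 4 * x ^ 2) by field; reflexivity.
Qed.

(** * The conical series *)

(** The sign [(-1)^k] is split off, so that what remains is a polynomial in [w] and [t] with
    nonnegative coefficients and can be compared monotonically in both variables. *)
Fixpoint cterm (w t : R) (k : nat) : R :=
  match k with
  | O => 1
  | S j => cterm w t j * ((t + (INR j + 1 / 2) ^ 2 * w) / INR (S j) ^ 2)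
  end.

Definition cseries (w t : R) : R := Series (fun k => (-1) ^ k * cterm w t k).

Lemma ratio_nonneg x k : 0 <= x -> 0 <= x / INR (S k) ^ 2.
Proof.
intros Hx; apply Rdiv_le_0_compat; [assumption|].
apply pow_lt, lt_0_INR; lia.
Qed.

Lemma cterm_nonneg w t k : 0 <= w -> 0 <= t -> 0 <= cterm w t k.
Proof.
intros Hw Ht; induction k as [|k IH]; [simpl; lra|].
cbn [cterm]; apply Rmult_le_pos; [assumption|].
apply ratio_nonneg; generalize (pow2_ge_0 (INR k + 1 / 2)); nra.
Qed.

Lemma cterm_le_w w v t k : 0 <= w <= v -> 0 <= t -> cterm w t k <= cterm v t k.
Proof.
intros Hw Ht; induction k as [|k IH]; [simpl; lra|].
assert (Hs := pow2_ge_0 (INR k + 1 / 2)).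
cbn [cterm]; apply Rmult_le_compat; [apply cterm_nonneg; lra| |assumption|].
- apply ratio_nonneg; nra.
- apply Rmult_le_compat_r; [|nra].
  apply Rlt_le, Rinv_0_lt_compat, pow_lt, lt_0_INR; lia.
Qed.

(* [cterm w t k] is a polynomial with nonnegative coefficients in [w], hence convex in [w]. *)
Lemma cterm_deform w v t k : 0 <= w <= v -> 0 < v -> 0 <= t ->
  0 <= cterm w t k - cterm 0 t k <= w / v * cterm v t k.
Proof.
intros Hw Hv Ht.
split; [generalize (cterm_le_w 0 w t k ltac:(lra) Ht); lra|].
induction k as [|k IH].
{ simpl; assert (0 <= w / v) by (apply Rdiv_le_0_compat; lra); lra. }
assert (Hq := cterm_le_w w v t k Hw Ht).
cbn [cterm]; rewrite !Rdiv_plus_distr.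
set (m := INR (S k) ^ 2) in *.
replace ((INR k + 1 / 2) ^ 2 * w / m) with ((INR k + 1 / 2) ^ 2 / m * w) by (unfold Rdiv; ring).
replace ((INR k + 1 / 2) ^ 2 * v / m) with ((INR k + 1 / 2) ^ 2 / m * v) by (unfold Rdiv; ring).
replace ((INR k + 1 / 2) ^ 2 * 0 / m) with 0 by (unfold Rdiv; ring).
assert (Hc : 0 <= (INR k + 1 / 2) ^ 2 / m) by (apply ratio_nonneg, pow2_ge_0).
assert (Htm : 0 <= t / m) by now apply ratio_nonneg.
set (c := (INR k + 1 / 2) ^ 2 / m) in *; set (a := t / m) in *.
apply Rle_trans with ((cterm w t k - cterm 0 t k) * a + cterm w t k * (c * w)); [apply Req_le; ring|].
apply Rle_trans with (w / v * cterm v t k * a + cterm v t k * (c * w)).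
- apply Rplus_le_compat; [now apply Rmult_le_compat_r|].
  apply Rmult_le_compat_r; [nra|assumption].
- apply Req_le; field; lra.
Qed.

(** The shift to [T + 1] replaces a derivative bound. Splitting the difference of products leaves,
    beside the inductive term with factor [T + b], one extra term at most
    [(t - u) * cterm w (T + 1) k]; the two add up to the factor [T + 1 + b] of the next term. *)
Lemma cterm_lipschitz w T t u k : 0 <= w -> 0 <= u <= t -> t <= T ->
  0 <= cterm w t k - cterm w u k <= (t - u) * cterm w (T + 1) k.
Proof.
intros Hw Hu Ht; induction k as [|k IH]; [simpl; lra|].
assert (Hr := cterm_nonneg w u k Hw ltac:(lra)).
assert (Hr' : cterm w u k <= cterm w (T + 1) k).
{ clear IH; revert Hr; induction k as [|k IH]; intros Hr; [simpl; lra|].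
  cbn [cterm]; apply Rmult_le_compat.
  - apply cterm_nonneg; lra.
  - apply ratio_nonneg; generalize (pow2_ge_0 (INR k + 1 / 2)); nra.
  - apply IH, cterm_nonneg; lra.
  - apply Rmult_le_compat_r; [|lra].
    apply Rlt_le, Rinv_0_lt_compat, pow_lt, lt_0_INR; lia. }
cbn [cterm].
set (b := (INR k + 1 / 2) ^ 2 * w).
assert (Hb : 0 <= b) by (generalize (pow2_ge_0 (INR k + 1 / 2)); unfold b; nra).
assert (Hm : 0 < / INR (S k) ^ 2) by (apply Rinv_0_lt_compat, pow_lt, lt_0_INR; lia).
unfold Rdiv; set (m := / INR (S k) ^ 2) in *.
set (X := cterm w t k) in *; set (Y := cterm w u k) in *; set (Z := cterm w (T + 1) k) in *.
replace (X * ((t + b) * m) - Y * ((u + b) * m))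
  with (m * ((X - Y) * (t + b) + Y * (t - u))) by ring.
replace ((t - u) * (Z * ((T + 1 + b) * m)))
  with (m * ((t - u) * Z * (T + b) + Z * (t - u))) by ring.
split.
- apply Rmult_le_pos; [lra|].
  apply Rplus_le_le_0_compat; apply Rmult_le_pos; lra.
- apply Rmult_le_compat_l; [lra|].
  apply Rplus_le_compat; [apply Rmult_le_compat; lra|apply Rmult_le_compat_r; lra].
Qed.

(** The same induction for the mixed difference in [w] and [t]; the additional term [b * (X - Y)] is
    a plain difference in [t], controlled by [cterm_lipschitz]. *)
Lemma cterm_deform_lipschitz w T t u k : 0 <= w -> 0 <= u <= t -> t <= T ->
  0 <= (cterm w t k - cterm 0 t k) - (cterm w u k - cterm 0 u k)
    <= (t - u) * (cterm w (T + 1) k - cterm 0 (T + 1) k).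
Proof.
intros Hw Hu Ht; induction k as [|k IH]; [simpl; lra|].
assert (HL := cterm_lipschitz w T t u k Hw Hu Ht).
assert (Hd := cterm_le_w 0 w u k ltac:(lra) ltac:(lra)).
(* The deformation is itself nondecreasing in [t], so its value at [u] is bounded by that at
   [T + 1]. *)
assert (Hd' : cterm w u k - cterm 0 u k <= cterm w (T + 1) k - cterm 0 (T + 1) k).
{ clear - Hw Hu Ht.
  induction k as [|k IH]; [simpl; lra|].
  assert (Hd := cterm_le_w 0 w u k ltac:(lra) ltac:(lra)).
  assert (HL := cterm_lipschitz w (T + 1) (T + 1) u k Hw ltac:(lra) ltac:(lra)).
  cbn [cterm]; rewrite !Rdiv_plus_distr, Rmult_0_r.
  assert (Hm : 0 < / INR (S k) ^ 2) by (apply Rinv_0_lt_compat, pow_lt, lt_0_INR; lia).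
  assert (Hb : 0 <= (INR k + 1 / 2) ^ 2 * w) by (generalize (pow2_ge_0 (INR k + 1 / 2)); nra).
  set (b := (INR k + 1 / 2) ^ 2 * w) in *; unfold Rdiv; set (m := / INR (S k) ^ 2) in *.
  apply Rle_trans with (m * ((cterm w u k - cterm 0 u k) * u + b * cterm w u k)); [apply Req_le; ring|].
  apply Rle_trans with (m * ((cterm w (T + 1) k - cterm 0 (T + 1) k) * (T + 1) + b * cterm w (T + 1) k)); [|apply Req_le; ring].
  apply Rmult_le_compat_l; [lra|].
  apply Rplus_le_compat; [apply Rmult_le_compat; lra|apply Rmult_le_compat_l; lra]. }
cbn [cterm]; rewrite !Rdiv_plus_distr, Rmult_0_r.
assert (Hm : 0 < / INR (S k) ^ 2) by (apply Rinv_0_lt_compat, pow_lt, lt_0_INR; lia).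
assert (Hb : 0 <= (INR k + 1 / 2) ^ 2 * w) by (generalize (pow2_ge_0 (INR k + 1 / 2)); nra).
set (b := (INR k + 1 / 2) ^ 2 * w) in *; unfold Rdiv; set (m := / INR (S k) ^ 2) in *.
set (X := cterm w t k) in *; set (Y := cterm w u k) in *; set (Z := cterm w (T + 1) k) in *.
set (X0 := cterm 0 t k) in *; set (Y0 := cterm 0 u k) in *; set (Z0 := cterm 0 (T + 1) k) in *.
replace (X * (t * m + b * m) - X0 * (t * m + 0 * m) - (Y * (u * m + b * m) - Y0 * (u * m + 0 * m)))
  with (m * ((X - X0 - (Y - Y0)) * t + (Y - Y0) * (t - u) + b * (X - Y))) by ring.
replace ((t - u) * (Z * (T * m + 1 * m + b * m) - Z0 * (T * m + 1 * m + 0 * m)))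
  with (m * ((t - u) * (Z - Z0) * T + (Z - Z0) * (t - u) + b * ((t - u) * Z))) by ring.
split.
- apply Rmult_le_pos; [lra|].
  repeat apply Rplus_le_le_0_compat; apply Rmult_le_pos; lra.
- apply Rmult_le_compat_l; [lra|].
  repeat apply Rplus_le_compat.
  + apply Rmult_le_compat; lra.
  + apply Rmult_le_compat_r; lra.
  + apply Rmult_le_compat_l; lra.
Qed.

Lemma ex_series_cterm_half t : 0 <= t -> ex_series (cterm (1 / 2) t).
Proof.
intros Ht.
assert (Hpos : forall k, 0 < cterm (1 / 2) t k).
{ induction k as [|k IH]; [simpl; lra|].
  cbn [cterm]; apply Rmult_lt_0_compat; [assumption|].
  apply Rdiv_lt_0_compat; [|apply pow_lt, lt_0_INR; lia].
  generalize (pos_INR k); nra. }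
apply ex_series_ext with (fun k => Rabs (cterm (1 / 2) t k)).
{ intros k; apply Rabs_pos_eq, Rlt_le, Hpos. }
apply ex_series_DAlembert with (1 / 2); [lra|intros k; apply Rgt_not_eq, Hpos|].
assert (Hinv := is_lim_seq_inv_INR_S).
(* With [N = k + 1] one has [(N - 1/2)^2 / 2 = N^2 / 2 - N / 2 + 1/8], so the ratio of successive
   terms tends to [1/2], the value of [w]. *)
apply is_lim_seq_ext with
  (fun k => (t + 1 / 8) * (/ INR (S k) * / INR (S k)) + (1 / 2 - 1 / 2 * / INR (S k))).
{ intros k; rewrite Rabs_pos_eq; [|apply Rlt_le, Rdiv_lt_0_compat; apply Hpos].
  cbn [cterm]; rewrite S_INR; field.
  split; [generalize (pos_INR k); lra|apply Rgt_not_eq, Hpos]. }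
replace (Finite (1 / 2)) with (Finite ((t + 1 / 8) * (0 * 0) + (1 / 2 - 1 / 2 * 0)))
  by (f_equal; ring).
apply is_lim_seq_plus'.
- apply is_lim_seq_mult'; [apply is_lim_seq_const|now apply is_lim_seq_mult'].
- apply is_lim_seq_minus'; [apply is_lim_seq_const|].
  apply is_lim_seq_mult'; [apply is_lim_seq_const|assumption].
Qed.

Lemma Rabs_pow_m1_mult k x : Rabs ((-1) ^ k * x) = Rabs x.
Proof. now rewrite Rabs_mult, pow_1_abs, Rmult_1_l. Qed.

Lemma ex_series_alt_le (a b : nat -> R) :
  (forall k, 0 <= a k <= b k) -> ex_series b -> ex_series (fun k => (-1) ^ k * a k).
Proof.
intros Hab Hb; apply (ex_series_le (K := R_AbsRing) (V := R_CompleteNormedModule) _ b); [|assumption].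
intros k; change (norm ?x) with (Rabs x).
rewrite Rabs_pow_m1_mult, Rabs_pos_eq; apply Hab.
Qed.

Lemma Series_alt_le (a b : nat -> R) :
  (forall k, 0 <= a k <= b k) -> ex_series b ->
  Rabs (Series (fun k => (-1) ^ k * a k)) <= Series b.
Proof.
intros Hab Hb.
assert (E : forall k, Rabs ((-1) ^ k * a k) = a k).
{ intros k; rewrite Rabs_pow_m1_mult; apply Rabs_pos_eq, Hab. }
eapply Rle_trans; [apply Series_Rabs|].
- apply (ex_series_le (K := R_AbsRing) (V := R_CompleteNormedModule) _ b); [|assumption].
  intros k; change (norm ?x) with (Rabs x); rewrite Rabs_Rabsolu, E; apply Hab.
- apply Series_le; [|assumption]; intros k; rewrite E; apply Hab.
Qed.

Lemma ex_series_cseries w t : 0 <= w <= 1 / 2 -> 0 <= t ->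
  ex_series (fun k => (-1) ^ k * cterm w t k).
Proof.
intros Hw Ht; apply ex_series_alt_le with (cterm (1 / 2) t); [|now apply ex_series_cterm_half].
intros k; split; [apply cterm_nonneg; lra|now apply cterm_le_w].
Qed.

Lemma cseries_deformation : linear_deformation cseries (cseries 0).
Proof.
intros X HX.
assert (HB := ex_series_cterm_half (X + 1) ltac:(lra)).
set (B := Series (cterm (1 / 2) (X + 1))) in *.
assert (HB0 : 0 <= B).
{ rewrite <- (Rmult_0_l (Series (cterm (1 / 2) (X + 1)))), <- Series_scal_l.
  apply Series_le; [|assumption].
  intros k; generalize (cterm_nonneg (1 / 2) (X + 1) k); lra. }
(* The factor 2 is the inverse of the reference value [w = 1/2] in the convexity bound, and the
   added 1 makes the constant visibly positive. Taking the majorant at [X + 1] lets the one sum [B]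
   serve both the uniform and the Lipschitz estimate. *)
exists (2 * B + 1); split; [lra|].
assert (Hdiff : forall w t, 0 <= w <= 1 / 2 -> 0 <= t ->
  cseries w t - cseries 0 t = Series (fun k => (-1) ^ k * (cterm w t k - cterm 0 t k))).
{ intros w t Hw Ht; unfold cseries.
  rewrite <- Series_minus by (apply ex_series_cseries; lra).
  apply Series_ext; intros k; ring. }
assert (Hscal : forall c, Series (fun k => c * cterm (1 / 2) (X + 1) k) = c * B)
  by (intros c; apply Series_scal_l).
assert (Hex : forall c, ex_series (fun k => c * cterm (1 / 2) (X + 1) k))
  by (intros c; now apply ex_series_scal_l with (a := cterm (1 / 2) (X + 1))).
assert (Hlip : forall w t u, 0 <= w <= 1 / 2 -> 0 <= u <= t -> t <= X ->
  Rabs ((cseries w t - cseries 0 t) - (cseries w u - cseries 0 u))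
    <= 2 * B * w * (t - u)).
{ intros w t u Hw Hu Ht.
  rewrite !Hdiff by lra.
  assert (He : forall v, 0 <= v <= X ->
    ex_series (fun k => (-1) ^ k * (cterm w v k - cterm 0 v k))).
  { intros v Hv; apply ex_series_ext with
      (fun k => minus ((-1) ^ k * cterm w v k) ((-1) ^ k * cterm 0 v k)).
    - intros k; unfold minus, plus, opp; simpl; ring.
    - apply (ex_series_minus (K := R_AbsRing) (V := R_NormedModule)); apply ex_series_cseries; lra. }
  rewrite <- Series_minus by (apply He; lra).
  rewrite (Series_ext _ (fun k => (-1) ^ k *
    ((cterm w t k - cterm 0 t k) - (cterm w u k - cterm 0 u k)))) by (intros k; ring).
  replace (2 * B * w * (t - u)) with ((t - u) * (w / (1 / 2)) * B) by field.
  rewrite <- Hscal; apply Series_alt_le; [|apply Hex].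
  intros k.
  assert (H1 := cterm_deform_lipschitz w X t u k ltac:(lra) Hu Ht).
  assert (H2 := cterm_deform w (1 / 2) (X + 1) k Hw ltac:(lra) ltac:(lra)).
  split; [lra|]; rewrite Rmult_assoc.
  eapply Rle_trans; [apply H1|apply Rmult_le_compat_l; lra]. }
intros w t u Hw Ht Hu; split.
- rewrite Hdiff by lra.
  apply Rle_trans with (w / (1 / 2) * B); [|replace (w / (1 / 2)) with (2 * w) by field; nra].
  rewrite <- Hscal; apply Series_alt_le; [|apply Hex].
  intros k.
  assert (H2 := cterm_deform w (1 / 2) t k Hw ltac:(lra) ltac:(lra)).
  split; [lra|]; eapply Rle_trans; [apply H2|].
  apply Rmult_le_compat_l; [apply Rdiv_le_0_compat; lra|].
  assert (H4 := cterm_lipschitz (1 / 2) (X + 1) (X + 1) t k ltac:(lra) ltac:(lra) ltac:(lra)).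
  lra.
- assert (Hw' : 2 * B * w <= (2 * B + 1) * w) by lra.
  destruct (Rle_lt_dec u t) as [H|H].
  + rewrite (Rabs_pos_eq (t - u)) by lra.
    eapply Rle_trans; [apply Hlip; lra|apply Rmult_le_compat_r; lra].
  + rewrite Rabs_minus_sym, (Rabs_minus_sym t u), (Rabs_pos_eq (u - t)) by lra.
    eapply Rle_trans; [apply Hlip; lra|apply Rmult_le_compat_r; lra].
Qed.

Lemma cterm_0 t k : (-1) ^ k * cterm 0 t k = bessel_coef k * t ^ k.
Proof.
induction k as [|k IH]; [unfold bessel_coef; simpl; field|].
rewrite bessel_coef_S; cbn [cterm].
replace ((-1) ^ S k) with (- (-1) ^ k) by (simpl; ring).
replace (t ^ S k) with (t * t ^ k) by (simpl; ring).
transitivity (- ((-1) ^ k * cterm 0 t k) * (t / INR (S k) ^ 2)).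
- rewrite Rmult_0_r, Rplus_0_r; ring.
- rewrite IH; field; apply not_0_INR; lia.
Qed.

Lemma cseries_0 t : cseries 0 t = bessel_fun t.
Proof. apply Series_ext; intros k; apply cterm_0. Qed.

(** * From the complex Gauss series to the real conical series *)

Lemma sum_n_RtoC (a : nat -> R) n :
  sum_n (G := C_AbelianGroup) (fun k => RtoC (a k)) n = RtoC (sum_n a n).
Proof.
induction n as [|n IH]; [now rewrite !sum_O|].
rewrite !sum_Sn, IH; symmetry; apply RtoC_plus.
Qed.

Lemma is_series_RtoC (a : nat -> R) (l : R) :
  is_series a l -> is_series (K := C_AbsRing) (V := C_NormedModule) (fun k => RtoC (a k)) (RtoC l).
Proof.
intros H; unfold is_series.
apply filterlim_ext with (fun n => RtoC (sum_n a n)).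
{ intros n; symmetry; apply sum_n_RtoC. }
apply (filterlim_comp _ _ _ (sum_n a) RtoC eventually (locally l)); [exact H|].
intros P [e He]; exists e; intros x Hx; apply He.
split; [exact Hx|apply (ball_center (M := R_UniformSpace))].
Qed.

Lemma rising_1 k : rising (RtoC 1) k = RtoC (INR (fact k)).
Proof.
induction k as [|k IH]; [reflexivity|].
cbn [rising]; rewrite IH, fact_simpl, mult_INR, S_INR, !RtoC_mult, RtoC_plus.
ring.
Qed.

Lemma pow_n_RtoC x k : pow_n (K := C_Ring) (RtoC x) k = RtoC (x ^ k).
Proof.
induction k as [|k IH]; [reflexivity|].
simpl; rewrite IH; symmetry; apply RtoC_mult.
Qed.

(** The two parameters are conjugate, so their rising factorials pair into the real factors
    [s^2 + (j + 1/2)^2]. Each takes one factor [w] from the power of the argument, which turns [s^2]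
    into [t = w * s^2]. *)
Lemma conical_coef s k w :
  scal (K := C_Ring) (pow_n (K := C_Ring) (RtoC (- w)) k)
    (hyp2F1_coef (RtoC (1 / 2) + Ci * RtoC s)%C (RtoC (1 / 2) - Ci * RtoC s)%C
       (RtoC 1) k) = RtoC ((-1) ^ k * cterm w (w * s ^ 2) k).
Proof.
rewrite pow_n_RtoC.
change (RtoC ((- w) ^ k) * hyp2F1_coef (RtoC (1 / 2) + Ci * RtoC s)%C
  (RtoC (1 / 2) - Ci * RtoC s)%C (RtoC 1) k
  = RtoC ((-1) ^ k * cterm w (w * s ^ 2) k))%C.
unfold hyp2F1_coef; rewrite rising_1.
assert (Hf : forall n, RtoC (INR (fact n)) <> 0%C).
{ intros n E; apply (INR_fact_neq_0 n); now apply RtoC_inj. }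
induction k as [|k IH].
{ simpl; rewrite !Rmult_1_r; field. }
cbn [rising cterm].
assert (HS : RtoC (INR (S k)) <> 0%C).
{ intros E; apply RtoC_inj in E; revert E; apply not_0_INR; lia. }
set (p := rising (RtoC (1 / 2) + Ci * RtoC s)%C k) in *.
set (q := rising (RtoC (1 / 2) - Ci * RtoC s)%C k) in *.
replace ((-1) ^ S k * (cterm w (w * s ^ 2) k
    * ((w * s ^ 2 + (INR k + 1 / 2) ^ 2 * w) / INR (S k) ^ 2)))
  with (((-1) ^ k * cterm w (w * s ^ 2) k)
    * (- w * (s ^ 2 + (INR k + 1 / 2) ^ 2) / INR (S k) ^ 2))
  by (simpl; unfold Rdiv; ring).
rewrite RtoC_mult, <- IH.
assert (E : ((RtoC (1 / 2) + Ci * RtoC s + RtoC (INR k))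
   * (RtoC (1 / 2) - Ci * RtoC s + RtoC (INR k)))%C
   = RtoC (s ^ 2 + (INR k + 1 / 2) ^ 2)).
{ apply injective_projections; simpl; field. }
rewrite fact_simpl, mult_INR, RtoC_mult.
rewrite (RtoC_div _ (INR (S k) ^ 2)) by (apply pow_nonzero, not_0_INR; lia).
replace (INR (S k) ^ 2) with (INR (S k) * INR (S k)) by ring.
rewrite !RtoC_mult, <- E.
replace ((- w) ^ S k) with (- w * (- w) ^ k) by reflexivity.
rewrite RtoC_mult.
field; split; [exact HS|apply Hf].
Qed.

(** The argument [(1 - y) / 2] is [- w], and [eta <= 1/3] means [w <= 1/2]: the point lies in the
    unit disc, where the chosen value must be the sum of the Gauss series, and in the range of the
    majorant. *)
Lemma conicalP_eq s eta : 0 < eta <= 1 / 3 ->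
  conicalP s ((1 + eta) / (1 - eta))
  = RtoC (cseries (eta / (1 - eta)) (eta / (1 - eta) * s ^ 2)).
Proof.
intros Heta.
set (w := eta / (1 - eta)).
assert (Hw : 0 < w <= 1 / 2).
{ unfold w; split; [apply Rdiv_lt_0_compat; lra|].
  apply Rmult_le_reg_r with (1 - eta); [lra|].
  unfold Rdiv; rewrite Rmult_assoc, Rinv_l; lra. }
unfold conicalP.
replace ((1 - (1 + eta) / (1 - eta)) / 2) with (- w) by (unfold w; field; lra).
set (a := (RtoC (1 / 2) + Ci * RtoC s)%C).
set (b := (RtoC (1 / 2) - Ci * RtoC s)%C).
assert (Hz : Cmod (RtoC (- w)) < 1).
{ rewrite Cmod_R, Rabs_Ropp, Rabs_pos_eq; lra. }
assert (Hser : is_pseries (hyp2F1_coef a b (RtoC 1)) (RtoC (- w))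
  (RtoC (cseries w (w * s ^ 2)))).
{ unfold is_pseries.
  apply is_series_ext with (fun k => RtoC ((-1) ^ k * cterm w (w * s ^ 2) k)).
  { intros k; symmetry; apply conical_coef. }
  apply is_series_RtoC, Series_correct, ex_series_cseries; [lra|].
  generalize (pow2_ge_0 s); nra. }
assert (H : is_hyp2F1 a b (RtoC 1) (RtoC (- w)) (hyp2F1 a b (RtoC 1) (RtoC (- w)))).
{ unfold hyp2F1; apply epsilon_spec; eexists; left; split; [exact Hz|exact Hser]. }
destruct H as [[_ H]|[H _]]; [|lra].
exact (filterlim_locally_unique (V := C_NormedModule) _ _ _ H Hser).
Qed.

(** * Transfer of the zeros back to the variable [s] *)

Lemma linear_deformation_ext f g h :
  (forall t, g t = h t) -> linear_deformation f g -> linear_deformation f h.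
Proof.
intros E H X HX; destruct (H X HX) as (K & HK & HH); exists K; split; [assumption|].
intros w t u; rewrite <- !E; apply HH.
Qed.

Lemma bessel_zero_deformation n : exists x C d,
  is_nth_pos_zero bessel_fun (S n) x /\ 0 < C /\ 0 < d /\
  forall w, 0 < w < d -> exists y,
    is_nth_pos_zero (cseries w) (S n) y /\ Rabs (y - x) <= C * w.
Proof.
apply (nth_zero_deformation cseries bessel_fun bessel_fun').
- exact (linear_deformation_ext _ _ _ cseries_0 cseries_deformation).
- exact is_derive_bessel_fun.
- intros t; eapply is_derive_continuity_pt, is_derive_bessel_fun'.
- rewrite bessel_fun_0; lra.
- exact bessel_fun_simple_zero.
- exact bessel_fun_unbounded_zeros.
Qed.

Lemma s_zero_eq n eta y : 0 < eta <= 1 / 3 ->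
  is_nth_pos_zero (cseries (eta / (1 - eta))) n y ->
  s_zero n eta = sqrt (y / (eta / (1 - eta))).
Proof.
intros Heta Hy; apply nth_pos_zero_eq.
apply (is_nth_pos_zero_sqrt (cseries (eta / (1 - eta)))).
- apply Rdiv_lt_0_compat; lra.
- intros s _; rewrite conicalP_eq by assumption.
  split; [intros E; now apply RtoC_inj|intros ->; reflexivity].
- assumption.
Qed.

Lemma j0_eq n x : is_nth_pos_zero bessel_fun n x -> j0 n = 2 * sqrt x.
Proof.
intros Hx.
replace (2 * sqrt x) with (sqrt (x / (1 / 4))).
- apply nth_pos_zero_eq, (is_nth_pos_zero_sqrt bessel_fun); [lra| |assumption].
  intros s _; now rewrite besselJ0_eq.
- replace (x / (1 / 4)) with (2 * 2 * x) by field.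
  rewrite sqrt_mult, sqrt_square; destruct Hx; lra.
Qed.

(* Since the zeros move by [O(w)], the error [s - j / (2 sqrt eta)] itself is
   [O(sqrt eta)]; this is what the exponential needs, not merely [s ~ j / (2 sqrt eta)]. *)
Lemma s_zero_error n : exists K d, 0 < j0 (S n) /\ 0 < d /\ forall eta, 0 < eta < d ->
  Rabs (s_zero (S n) eta - j0 (S n) / (2 * sqrt eta)) <= K * sqrt eta.
Proof.
destruct (bessel_zero_deformation n) as (x & C & d & Hx & HC & Hd & H).
assert (Hx0 : 0 < x) by apply Hx.
assert (Hsx : 0 < sqrt x) by now apply sqrt_lt_R0.
rewrite (j0_eq _ _ Hx).
(* Here [w <= 2 * eta], so [d / 2] ensures [w < d], and [a = y * (1 - eta)] differs from [x] by at
   most [(2 * C + x) * eta]. Rationalising the difference of square roots divides this by at least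
   [sqrt x * sqrt eta]. *)
exists ((2 * C + x) / sqrt x), (Rmin (1 / 3) (d / 2)).
split; [lra|split; [apply Rmin_pos; lra|]].
intros eta [He0 He]; apply Rmin_Rgt_l in He; destruct He as [He1 He2].
set (w := eta / (1 - eta)).
assert (Hw0 : 0 < w) by (apply Rdiv_lt_0_compat; lra).
assert (Ew : w * (1 - eta) = eta) by (unfold w; field; lra).
assert (Hw : w <= 2 * eta) by nra.
destruct (H w) as (y & Hy & Hyx); [lra|].
assert (Hy0 : 0 < y) by apply Hy.
rewrite (s_zero_eq (S n) eta y ltac:(lra) Hy); fold w.
replace (y / w) with (y * (1 - eta) / eta) by (unfold w; field; lra).
assert (Hse : 0 < sqrt eta) by now apply sqrt_lt_R0.
rewrite sqrt_div_alt by assumption.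
set (a := y * (1 - eta)).
assert (Ha0 : 0 < a) by (apply Rmult_lt_0_compat; lra).
assert (Hsa : 0 < sqrt a) by now apply sqrt_lt_R0.
replace (sqrt a / sqrt eta - 2 * sqrt x / (2 * sqrt eta))
  with ((a - x) / ((sqrt a + sqrt x) * sqrt eta)).
2:{ rewrite <- (sqrt_sqrt a) at 1 by lra; rewrite <- (sqrt_sqrt x) at 1 by lra.
    field; lra. }
assert (Hax : Rabs (a - x) <= (2 * C + x) * eta).
{ unfold a; apply Rabs_le_between in Hyx; apply Rabs_le_between.
  assert (C * w <= C * (2 * eta)) by (apply Rmult_le_compat_l; lra).
  replace (y * (1 - eta) - x) with ((y - x) * (1 - eta) - x * eta) by ring.
  assert (0 <= x * eta) by nra.
  assert (0 <= C * eta) by nra.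
  nra. }
rewrite Rabs_div, (Rabs_pos_eq (_ * _)) by nra.
apply Rle_trans with ((2 * C + x) * eta / (sqrt x * sqrt eta)).
- apply Rmult_le_compat; [apply Rabs_pos| |assumption|].
  + apply Rlt_le, Rinv_0_lt_compat; nra.
  + apply Rinv_le_contravar; nra.
- apply Req_le; rewrite <- (sqrt_sqrt eta) at 1 by lra; field; lra.
Qed.

(** * Asymptotics *)

Lemma filterlim_Rplus {T : Type} (F : (T -> Prop) -> Prop) {FF : Filter F} (f g : T -> R) a b :
  filterlim f F (locally a) -> filterlim g F (locally b) ->
  filterlim (fun x => f x + g x) F (locally (a + b)).
Proof.
intros Hf Hg; apply (filterlim_comp_2 f g Rplus Hf Hg).
apply (filterlim_plus (K := R_AbsRing) (V := R_NormedModule)).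
Qed.

Lemma filterlim_Rmult {T : Type} (F : (T -> Prop) -> Prop) {FF : Filter F} (f g : T -> R) a b :
  filterlim f F (locally a) -> filterlim g F (locally b) ->
  filterlim (fun x => f x * g x) F (locally (a * b)).
Proof.
intros Hf Hg; apply (filterlim_comp_2 f g Rmult Hf Hg).
apply (filterlim_mult (K := R_AbsRing)).
Qed.

Lemma filterlim_sqrt_0 : filterlim sqrt (at_right 0) (locally 0).
Proof.
apply (filterlim_filter_le_1 _ (filter_le_within (fun u => 0 < u))).
rewrite <- sqrt_0 at 2; apply continuity_pt_filterlim, continuity_pt_sqrt; lra.
Qed.

Lemma s_zero_error_lim n :
  filterlim (fun eta => s_zero (S n) eta - j0 (S n) / (2 * sqrt eta)) (at_right 0) (locally 0).
Proof.
destruct (s_zero_error n) as (K & d & _ & Hd & H).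
assert (HK : filterlim (fun eta => Rabs K * sqrt eta) (at_right 0) (locally 0)).
{ replace (locally 0) with (locally (Rabs K * 0)) by (f_equal; ring).
  apply (filterlim_comp _ _ _ sqrt (fun x => Rabs K * x) _ (locally 0)); [apply filterlim_sqrt_0|].
  apply (filterlim_scal_r (K := R_AbsRing) (V := R_NormedModule)). }
intros P [e He]; apply filterlim_locally with (eps := e) in HK.
unfold filtermap.
assert (Hev : at_right 0 (fun eta => 0 < eta < d)).
{ exists (mkposreal d Hd); intros y Hy Hy0; split; [assumption|].
  apply Rabs_lt_between' in Hy; simpl in Hy; lra. }
generalize (filter_and _ _ HK Hev); apply filter_imp.
intros eta [H1 H2]; apply He.
change (Rabs (Rabs K * sqrt eta - 0) < e) in H1.
change (Rabs (s_zero (S n) eta - j0 (S n) / (2 * sqrt eta) - 0) < e).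
rewrite Rminus_0_r in *.
rewrite Rabs_mult, Rabs_Rabsolu in H1.
apply Rle_lt_trans with (2 := H1).
eapply Rle_trans; [apply (H eta H2)|].
rewrite <- Rabs_mult; apply Rle_abs.
Qed.

Lemma at_right_0_pos : at_right 0 (fun eta => 0 < eta).
Proof. exists (mkposreal 1 Rlt_0_1); intros y _ Hy; exact Hy. Qed.

Lemma s_zero_asymp n :
  asymp_equiv (at_right 0) (s_zero (S n)) (fun eta => j0 (S n) / (2 * sqrt eta)).
Proof.
destruct (s_zero_error n) as (_ & _ & Hj & _ & _).
unfold asymp_equiv.
apply filterlim_ext_loc with (fun eta =>
  1 + 2 / j0 (S n) * (sqrt eta * (s_zero (S n) eta - j0 (S n) / (2 * sqrt eta)))).
{ generalize at_right_0_pos; apply filter_imp; intros eta He.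
  assert (Hse : 0 < sqrt eta) by now apply sqrt_lt_R0.
  field; lra. }
replace (locally 1) with (locally (1 + 2 / j0 (S n) * (0 * 0))) by (f_equal; ring).
apply filterlim_Rplus; [apply _|apply filterlim_const|].
apply filterlim_Rmult; [apply _|apply filterlim_const|].
apply filterlim_Rmult; [apply _|apply filterlim_sqrt_0|apply s_zero_error_lim].
Qed.

Lemma tanh_exp x : tanh x = (1 - exp (- 2 * x)) / (1 + exp (- 2 * x)).
Proof.
unfold tanh, sinh, cosh.
replace (- 2 * x) with (- x + - x) by ring; rewrite exp_plus, exp_Ropp.
assert (H := exp_pos x).
field; split; nra.
Qed.

(** This is the derivative at 0, equal to 2, of [ln (1 + q) - ln (1 - q)]. With [q = exp (- 2 * x)]
    that function is [- ln (tanh x)]. The neighbourhood is punctured because of the division by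
    [q]. *)
Lemma ln_ratio_lim :
  filterlim (fun q => (ln (1 + q) - ln (1 - q)) / (2 * q)) (locally' 0) (locally 1).
Proof.
assert (H : is_derive (fun q => ln (1 + q) - ln (1 - q)) 0 2).
{ auto_derive; [lra|field]. }
intros P [e He].
apply is_derive_Reals in H.
destruct (H (2 * e)) as [d Hd]; [generalize (cond_pos e); lra|].
exists d; intros q Hq Hq0; apply He.
change (Rabs (q - 0) < d) in Hq; rewrite Rminus_0_r in Hq.
specialize (Hd q Hq0 Hq).
rewrite Rplus_0_l, Rplus_0_r, Rminus_0_r, ln_1, Rminus_diag, Rminus_0_r in Hd.
change (Rabs ((ln (1 + q) - ln (1 - q)) / (2 * q) - 1) < e).
replace ((ln (1 + q) - ln (1 - q)) / (2 * q) - 1)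
  with (/ 2 * ((ln (1 + q) - ln (1 - q)) / q - 2)) by (field; assumption).
rewrite Rabs_mult, (Rabs_pos_eq (/ 2)) by lra; lra.
Qed.

Lemma exp_div_sqrt_lim c : 0 < c ->
  filterlim (fun eta => exp (- (c / sqrt eta))) (at_right 0) (locally 0).
Proof.
intros Hc.
apply (filterlim_comp _ _ _ (fun eta => - (c / sqrt eta)) exp _ (Rbar_locally m_infty));
  [|exact is_lim_exp_m].
intros P [M HM].
assert (Hm : 0 < c / (Rabs M + 1)).
{ apply Rdiv_lt_0_compat; generalize (Rabs_pos M); lra. }
assert (H := filterlim_sqrt_0).
apply filterlim_locally with (eps := mkposreal _ Hm) in H.
unfold filtermap; generalize (filter_and _ _ H at_right_0_pos); apply filter_imp.
intros eta [H1 H2]; apply HM.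
change (Rabs (sqrt eta - 0) < c / (Rabs M + 1)) in H1.
assert (Hse : 0 < sqrt eta) by now apply sqrt_lt_R0.
rewrite Rminus_0_r, Rabs_pos_eq in H1 by lra.
assert (HM1 := Rabs_pos M). assert (HM2 := Rle_abs (- M)); rewrite Rabs_Ropp in HM2.
assert (Rabs M + 1 < c / sqrt eta); [|lra].
apply Rmult_lt_reg_r with (sqrt eta); [assumption|].
replace (c / sqrt eta * sqrt eta) with c by (field; lra).
apply Rmult_lt_compat_l with (r := Rabs M + 1) in H1; [|lra].
replace ((Rabs M + 1) * (c / (Rabs M + 1))) with c in H1 by (field; lra).
exact H1.
Qed.

(** With [q = exp (- 2 * PI * s_n)], the negativity is asymptotic to [2 * q / ln 2]. Replacing [s_n]
    by its leading term changes [q] by the factor [r], which tends to 1 because the absolute error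
    of [s_n] tends to 0. *)
Lemma log_neg_asymp n :
  asymp_equiv (at_right 0) (log_neg (S n))
    (fun eta => 2 / ln 2 * exp (- PI * j0 (S n) / sqrt eta)).
Proof.
destruct (s_zero_error n) as (_ & _ & Hj & _ & _).
unfold asymp_equiv.
set (er := fun eta => s_zero (S n) eta - j0 (S n) / (2 * sqrt eta)).
set (r := fun eta => exp (- 2 * PI * er eta)).
set (q := fun eta => exp (- (PI * j0 (S n) / sqrt eta)) * r eta).
assert (Hr : filterlim r (at_right 0) (locally 1)).
{ apply (filterlim_comp _ _ _ er (fun x => exp (- 2 * PI * x)) _ (locally 0)).
  - apply s_zero_error_lim.
  - replace 1 with (exp (- 2 * PI * 0)) by (rewrite Rmult_0_r; apply exp_0).
    apply (continuity_pt_filterlim (fun x => exp (- 2 * PI * x))).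
    apply derivable_continuous_pt; reg. }
assert (Hq : filterlim q (at_right 0) (locally' 0)).
{ assert (H : filterlim q (at_right 0) (locally 0)).
  { replace (locally 0) with (locally (0 * 1)) by (f_equal; ring).
    apply filterlim_Rmult; [apply _| |exact Hr].
    apply exp_div_sqrt_lim, Rmult_lt_0_compat; [apply PI_RGT_0|assumption]. }
  (* Being a product of exponentials, [q] never vanishes, so its limit may be taken in the punctured
     neighbourhood. *)
  intros P HP; generalize (H _ HP); unfold filtermap; apply filter_imp.
  intros eta He; apply He.
  unfold q, r; apply Rgt_not_eq, Rmult_lt_0_compat; apply exp_pos. }
assert (Hln2 : 0 < ln 2) by (rewrite <- ln_1; apply ln_increasing; lra).
assert (Hq1 : at_right 0 (fun eta => q eta < 1)).
{ apply (Hq (fun y => y < 1)); exists (mkposreal 1 Rlt_0_1); intros y Hy _.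
  apply Rabs_lt_between' in Hy; simpl in Hy; lra. }
apply filterlim_ext_loc with
  (fun eta => (ln (1 + q eta) - ln (1 - q eta)) / (2 * q eta) * r eta).
{ generalize (filter_and _ _ at_right_0_pos Hq1); apply filter_imp.
  intros eta [He Hq1'].
  assert (Hse : 0 < sqrt eta) by now apply sqrt_lt_R0.
  assert (Hq0 : 0 < q eta) by (unfold q, r; apply Rmult_lt_0_compat; apply exp_pos).
  unfold log_neg; rewrite tanh_exp.
  replace (exp (- 2 * (PI * s_zero (S n) eta))) with (q eta).
  2:{ unfold q, r, er; rewrite <- exp_plus; f_equal; field; lra. }
  rewrite ln_div by lra.
  replace (- PI * j0 (S n) / sqrt eta) with (- (PI * j0 (S n) / sqrt eta)) by (field; lra).
  unfold q at 3; field.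
  repeat split; try (apply Rgt_not_eq, exp_pos); lra. }
replace (locally 1) with (locally (1 * 1)) by (f_equal; ring).
apply filterlim_Rmult; [apply _| |exact Hr].
exact (filterlim_comp _ _ _ q _ _ (locally' 0) _ Hq ln_ratio_lim).
Qed.

Lemma large_separation_cross_ratio :
  filterlim (fun p : R * R => let (l, d) := p in / (1 + d / l) ^ 2)
    large_separation (at_right 0).
Proof.
(* If [d / l > 1 / e], then [(1 + d / l)^2] exceeds [1 / e] as well. *)
intros P [e He]; exists (/ e); intros l d Hl Hd HM.
assert (Hle := cond_pos e).
assert (Hie : 0 < / e) by now apply Rinv_0_lt_compat.
assert (Hpos : 0 < / (1 + d / l) ^ 2).
{ apply Rinv_0_lt_compat, pow_lt; lra. }
apply He; [|assumption].
change (Rabs (/ (1 + d / l) ^ 2 - 0) < e).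
rewrite Rminus_0_r, Rabs_pos_eq by lra.
rewrite <- (Rinv_inv e); apply Rinv_lt_contravar; [|nra].
apply Rmult_lt_0_compat; [assumption|apply pow_lt; lra].
Qed.

Theorem mainTheorem4 :
  forall n : nat, (1 <= n)%nat ->
    asymp_equiv (at_right 0)
      (fun eta : R => s_zero n eta)
      (fun eta : R => j0 n / (2 * sqrt eta)) /\
    asymp_equiv (at_right 0)
      (fun eta : R => log_neg n eta)
      (fun eta : R => 2 / ln 2 * exp (- PI * j0 n / sqrt eta)) /\
    (forall a l d : R, 0 < l -> 0 < d ->
      cross_ratio a (a + l) (a + l + d) (a + l + d + l) = / (1 + d / l) ^ 2) /\
    asymp_equiv large_separation
      (fun p : R * R => let (l, d) := p in log_neg n (/ (1 + d / l) ^ 2))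
      (fun p : R * R => let (l, d) := p in
         2 / ln 2 * exp (- PI * j0 n * (1 + d / l))).
Proof.
intros [|n] Hn; [lia|].
split; [apply s_zero_asymp|].
split; [apply log_neg_asymp|].
split.
- intros a l d Hl Hd; unfold cross_ratio; field; lra.
- intros P HP.
  (* The limit in [eta] is composed with the cross ratio, for which [1 / sqrt eta] is exactly
     [1 + d / l]. *)
  destruct (large_separation_cross_ratio _ (log_neg_asymp n P HP)) as [M HM].
  exists (Rmax M 0); intros l d Hl Hd HMd.
  assert (H1 := Rmax_l M 0). assert (H2 := Rmax_r M 0).
  generalize (HM l d Hl Hd ltac:(lra)); cbv beta iota.
  replace (- PI * j0 (S n) / sqrt (/ (1 + d / l) ^ 2))
    with (- PI * j0 (S n) * (1 + d / l)); [exact (fun H => H)|].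
  rewrite sqrt_inv, sqrt_pow2 by lra; unfold Rdiv at 2; now rewrite Rinv_inv.
Qed.
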